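(* Let $Q$ be a quandle such that the natural map $\theta:Q\to G_Q$ is injective, and let $A\subseteq Q$ be a set of representatives of the orbits of $Q$. Then $Q$ is isomorphic to $Q(G_Q,\theta(A))$.
   Context: A quandle is a set $Q$ with a binary operation $*$ such that: (r1) for every $x\in Q$ the map $S_x:y\mapsto y*x$ is a bijection of $Q$; (r2) $(x*y)*z=(x*z)*(y*z)$ for all $x,y,z\in Q$; (q1) $x*x=x$ for all $x\in Q$. The maps $S_x$ are automorphisms of $Q$, and $\mathrm{Inn}(Q)=\langle S_x\mid x\in Q\rangle$ is the group of inner automorphisms. Orbits of $Q$ are the orbits of the action of $\mathrm{Inn}(Q)$ on $Q$; a set of representatives of orbits contains exactly one element of each orbit. The enveloping group $G_Q$ is the group with generating set $Q$ and defining relations $x*y=y^{-1}xy$ for all $x,y\in Q$; the natural map $\theta:Q\to G_Q$ sends $x\in Q$ to the corresponding generator. For a group $G$ and a subset $A\subseteq G$, the $(G,A)$-quandle $Q(G,A)$ is the quotient of the set $A\times G$ by the equivalence relation $(a,gh)\sim(a,h)$ for $a\in A$, $h\in G$, $g\in C_G(a)=\{x\in G\mid xa=ax\}$, with the (well-defined) quandle operation $[(a,u)]*[(b,v)]=[(a,uv^{-1}bv)]$. *)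

(* Defs.v *)
From HB Require Import structures.
From mathcomp Require Import all_boot.
From mathcomp Require Import boolp classical_sets.

Set Implicit Arguments.
Unset Strict Implicit.
Unset Printing Implicit Defensive.

Local Open Scope classical_set_scope.
Local Open Scope quotient_scope.
Local Open Scope group_scope.

Reserved Notation "x *q y" (at level 40, left associativity).

HB.mixin Record isQuandle (Q : Type) := {
  qop : Q -> Q -> Q;
  qop_bij : forall x, bijective (fun y => qop y x);
  qopDr : forall x y z, qop (qop x y) z = qop (qop x z) (qop y z);
  qopxx : forall x, qop x x = x
}.

#[short(type="quandleType")]
HB.structure Definition Quandle := {Q of isQuandle Q}.

Notation "x *q y" := (qop x y).

Definition quandle_iso (Q Q' : quandleType) : Prop :=
  exists f : Q -> Q', bijective f /\ forall x y, f (x *q y) = f x *q f y.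

Section InnerAutomorphisms.
Variable Q : quandleType.

Definition qtrans (x : Q) : Q -> Q := fun y => y *q x.

Definition perm_subgroup (H : set (Q -> Q)) : Prop :=
  [/\ forall f, H f -> bijective f,
      H id,
      forall f g, H f -> H g -> H (f \o g)
    & forall f g, H f -> cancel f g -> cancel g f -> H g].

Definition Inn : set (Q -> Q) := smallest perm_subgroup (range qtrans).

Definition qorbit (x : Q) : set Q := [set f x | f in Inn].

Definition orbit_representatives (A : set Q) : Prop :=
  forall x, exists! a, (A `&` qorbit x) a.

End InnerAutomorphisms.

(* A word over the generators X; the letter (x, true) stands for x and
   (x, false) for x^-1. *)
Definition gword (X : Type) := seq ({classic X} * bool).

Section PresentedGroup.
Variables (X : Type) (R : gword X -> gword X -> Prop).

(* R u v is the defining relation u = v. *)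
Inductive gword_cong : gword X -> gword X -> Prop :=
| GwRel u v : R u v -> gword_cong u v
| GwInv x b : gword_cong [:: (x, b); (x, ~~ b)] [::]
| GwCat u u' v v' :
    gword_cong u u' -> gword_cong v v' -> gword_cong (u ++ v) (u' ++ v')
| GwRefl u : gword_cong u u
| GwSym u v : gword_cong u v -> gword_cong v u
| GwTrans u v w : gword_cong u v -> gword_cong v w -> gword_cong u w.

Definition gword_eqv : rel (gword X) := fun u v => `[< gword_cong u v >].

Lemma gword_eqv_refl : reflexive gword_eqv.
Proof. by move=> u; apply/asboolP; exact: GwRefl. Qed.

Lemma gword_eqv_sym : symmetric gword_eqv.
Proof. by move=> u v; apply/asboolP/asboolP; exact: GwSym. Qed.

Lemma gword_eqv_trans : transitive gword_eqv.
Proof.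
by move=> v u w /asboolP uv /asboolP vw; apply/asboolP; exact: GwTrans uv vw.
Qed.

Canonical gword_equiv :=
  EquivRel gword_eqv gword_eqv_refl gword_eqv_sym gword_eqv_trans.

Definition presented := {eq_quot gword_equiv}.
HB.instance Definition _ := Choice.on presented.
HB.instance Definition _ := EqQuotient.on presented.

Lemma presentedP (u v : gword X) :
  \pi_presented u = \pi_presented v <-> gword_cong u v.
Proof. by split=> [/eqmodP/asboolP//|uv]; apply/eqmodP/asboolP. Qed.

Definition gword_inv (u : gword X) : gword X :=
  rev [seq (p.1, ~~ p.2) | p <- u].

Lemma gword_invK : involutive gword_inv.
Proof.
move=> u; rewrite /gword_inv map_rev revK -map_comp -[RHS]map_id.
by apply: eq_map => -[x b] /=; rewrite negbK.
Qed.

Lemma gword_cong_invr u : gword_cong (u ++ gword_inv u) [::].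
Proof.
elim: u => [|[x b] u IHu]; first exact: GwRefl.
have H : gword_cong ([:: (x, b)] ++ (u ++ gword_inv u) ++ [:: (x, ~~ b)])
           ([:: (x, b)] ++ [::] ++ [:: (x, ~~ b)]).
  by apply: GwCat; [exact: GwRefl | apply: GwCat IHu (GwRefl _)].
apply: GwTrans (GwInv x b); move: H.
by rewrite /gword_inv /= rev_cons -cats1 !catA.
Qed.

Lemma gword_cong_invl u : gword_cong (gword_inv u ++ u) [::].
Proof. by have := gword_cong_invr (gword_inv u); rewrite gword_invK. Qed.

Lemma gword_cong_inv u v :
  gword_cong u v -> gword_cong (gword_inv u) (gword_inv v).
Proof.
move=> uv; have H1 : gword_cong (gword_inv u ++ v ++ gword_inv v) (gword_inv u).
  rewrite -[X in gword_cong _ X]cats0.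
  by apply: GwCat; [exact: GwRefl | exact: gword_cong_invr].
apply: GwTrans (GwSym H1) _; rewrite catA -[X in gword_cong _ X]cat0s.
apply: GwCat; last exact: GwRefl.
apply: GwTrans (gword_cong_invl u); apply: GwCat; first exact: GwRefl.
exact: GwSym.
Qed.

Definition presented_one : presented := lift_cst presented [::].
Definition presented_mul := lift_op2 presented cat.
Definition presented_inv := lift_op1 presented gword_inv.

Canonical pi_presented_one := PiConst presented_one.

Lemma pi_presented_mul :
  {morph \pi_presented : u v / u ++ v >-> presented_mul u v}.
Proof.
move=> u v; unlock presented_mul; apply/presentedP.
by apply: GwCat; apply/presentedP; rewrite reprK.
Qed.
Canonical pi_presented_mul_morph := PiMorph2 pi_presented_mul.

Lemma pi_presented_inv :
  {morph \pi_presented : u / gword_inv u >-> presented_inv u}.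
Proof.
move=> u; unlock presented_inv; apply/presentedP.
by apply: gword_cong_inv; apply/presentedP; rewrite reprK.
Qed.
Canonical pi_presented_inv_morph := PiMorph1 pi_presented_inv.

Lemma presented_mulA : associative presented_mul.
Proof.
by elim/quotW=> u; elim/quotW=> v; elim/quotW=> w; rewrite !piE catA.
Qed.

Lemma presented_mul1 : left_id presented_one presented_mul.
Proof. by elim/quotW=> u; rewrite !piE. Qed.

Lemma presented_mulr1 : right_id presented_one presented_mul.
Proof. by elim/quotW=> u; rewrite !piE cats0. Qed.

Lemma presented_mulV : left_inverse presented_one presented_inv presented_mul.
Proof.
elim/quotW=> u; rewrite !piE.
by apply/presentedP; exact: gword_cong_invl.
Qed.

Lemma presented_mulrV : right_inverse presented_one presented_inv presented_mul.
Proof.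
elim/quotW=> u; rewrite !piE.
by apply/presentedP; exact: gword_cong_invr.
Qed.

HB.instance Definition _ := isGroup.Build presented presented_mulA
  presented_mul1 presented_mulr1 presented_mulV presented_mulrV.

Definition presented_gen (x : X) : presented :=
  \pi_presented [:: (x : {classic X}, true)].

End PresentedGroup.

Section EnvelopingGroup.
Variable Q : quandleType.

Variant env_rel : gword Q -> gword Q -> Prop :=
| EnvRel (x y : Q) :
    env_rel [:: (x *q y, true)] [:: (y, false); (x, true); (y, true)].

Definition env_group : groupType := presented env_rel.

Definition env_map : Q -> env_group := @presented_gen Q env_rel.

Lemma env_mapM x y : env_map (x *q y) = (env_map y)^-1 * env_map x * env_map y.
Proof.
rewrite /env_map /presented_gen.
pose l (z : Q) (b : bool) : gword Q := [:: (z, b)].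
transitivity (\pi_(presented env_rel) (l y false ++ l x true ++ l y true)).
  by apply/presentedP; apply: GwRel.
rewrite -[_^-1]/(presented_inv _).
by rewrite -mulgA !pi_presented_mul (pi_presented_inv env_rel (l y true)).
Qed.

End EnvelopingGroup.

Section GAQuandle.
Variables (G : groupType) (A : set G).

(* (a, g * h) ~ (a, h) for g centralising a; this is already an equivalence
   relation, so no closure is taken. *)
Definition gaq_eqv : rel (A * G) := fun p q =>
  `[< p.1 = q.1 /\ exists2 g, commute g (\val p.1) & p.2 = g * q.2 >].

Lemma gaq_eqv_refl : reflexive gaq_eqv.
Proof.
move=> [a u]; apply/asboolP; split=> //=; exists 1; last by rewrite mul1g.
exact/commute_sym/commute1.
Qed.

Lemma gaq_eqv_sym : symmetric gaq_eqv.
Proof.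
have H p q : gaq_eqv p q -> gaq_eqv q p.
  case: p q => [a u] [b v] /asboolP[/= <- [g cga ->]]; apply/asboolP.
  split=> //=; exists g^-1; last by rewrite mulKg.
  exact/commute_sym/commuteV/commute_sym.
by move=> p q; apply/idP/idP; exact: H.
Qed.

Lemma gaq_eqv_trans : transitive gaq_eqv.
Proof.
move=> [b v] [a u] [c w] /asboolP[/= <- [g cga ->]] /asboolP[/= <- [h cha ->]].
apply/asboolP; split=> //=; exists (g * h); last by rewrite mulgA.
exact/commute_sym/commuteM/commute_sym/cha/commute_sym.
Qed.

Canonical gaq_equiv :=
  EquivRel gaq_eqv gaq_eqv_refl gaq_eqv_sym gaq_eqv_trans.

Definition gaq := {eq_quot gaq_equiv}.
HB.instance Definition _ := Choice.on gaq.
HB.instance Definition _ := EqQuotient.on gaq.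

Lemma gaqP (p q : A * G) : \pi_gaq p = \pi_gaq q <->
  p.1 = q.1 /\ exists2 g, commute g (\val p.1) & p.2 = g * q.2.
Proof. by split=> [/eqmodP/asboolP//|pq]; apply/eqmodP/asboolP. Qed.

(* Defined on chosen representatives; gaq_opE shows that the choice is
   irrelevant. *)
Definition gaq_op (c d : gaq) : gaq :=
  let: (a, u) := repr c in
  let: (b, v) := repr d in
  \pi_gaq (a, u * v^-1 * \val b * v).

Lemma gaq_opE (a b : A) (u v : G) :
  gaq_op (\pi_gaq (a, u)) (\pi_gaq (b, v)) =
  \pi_gaq (a, u * v^-1 * \val b * v).
Proof.
rewrite /gaq_op.
case E : (repr _) => [a' u']; case F : (repr _) => [b' v'].
have /gaqP[/= ? [g cga ->]] : \pi_gaq (a', u') = \pi_gaq (a, u).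
  by rewrite -E reprK.
have /gaqP[/= ? [h chb ->]] : \pi_gaq (b', v') = \pi_gaq (b, v).
  by rewrite -F reprK.
subst a' b'; apply/gaqP; split=> //=; exists g => //.
by rewrite invgM !mulgA -[in LHS](mulgA _ _ h) -chb !mulgA mulgVK.
Qed.

Lemma gaq_op_bij d : bijective (fun c => gaq_op c d).
Proof.
elim/quotW: d => -[b v].
exists (fun c =>
  let: (a, u) := repr c in \pi_gaq (a, u * v^-1 * (\val b)^-1 * v)).
  elim/quotW=> -[a u]; rewrite gaq_opE.
  case E : (repr _) => [a' u'].
  have /gaqP[/= ? [g cga ->]] :
      \pi_gaq (a', u') = \pi_gaq (a, u * v^-1 * \val b * v) by rewrite -E reprK.
  subst a'; apply/gaqP; split=> //=; exists g => //.
  by rewrite !mulgA mulgK mulgK mulgVK.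
elim/quotW=> -[a u].
case E : (repr _) => [a' u'].
have /gaqP[/= ? [g cga ->]] : \pi_gaq (a', u') = \pi_gaq (a, u).
  by rewrite -E reprK.
subst a'; rewrite gaq_opE; apply/gaqP; split=> //=; exists g => //.
by rewrite mulgK !mulgVK.
Qed.

Lemma gaq_opDr c d e : gaq_op (gaq_op c d) e = gaq_op (gaq_op c e) (gaq_op d e).
Proof.
elim/quotW: c => -[a u]; elim/quotW: d => -[b v]; elim/quotW: e => -[c w].
rewrite !gaq_opE; congr (\pi_gaq (a, _)).
by rewrite !invgM invgK !mulgA !mulgK !mulgVK.
Qed.

Lemma gaq_opxx c : gaq_op c c = c.
Proof.
elim/quotW: c => -[a u]; rewrite gaq_opE mulgV mul1g; apply/gaqP.
by split=> //=; exists (\val a); first exact: commute_refl.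
Qed.

HB.instance Definition _ := isQuandle.Build gaq gaq_op_bij gaq_opDr gaq_opxx.

End GAQuandle.

(* Main.v *)
(* Mapping [(a, u)] to u^-1 a u defines a homomorphism from Q(G, A) to the
   conjugation quandle of G. It is injective as soon as distinct elements of A
   are not conjugate, and its image is the union of the conjugacy classes of
   the elements of A. In G_Q, conjugation by a generator y sends theta x to
   theta (x * y); hence, theta being injective, the conjugates of theta x are
   exactly the images of the points of the orbit of x. So for A a set of orbit
   representatives, Q and Q(G_Q, theta(A)) embed in the conjugation quandle
   of G_Q with the same image. *)
Require Import Defs.
From HB Require Import structures.
From mathcomp Require Import all_boot.
From mathcomp Require Import boolp classical_sets.

Set Implicit Arguments.
Unset Strict Implicit.
Unset Printing Implicit Defensive.

Local Open Scope classical_set_scope.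

Section ConjugationValue.
Local Open Scope quotient_scope.
Local Open Scope group_scope.
Variables (G : groupType) (A : set G).

Definition gaq_conj (c : gaq A) : G := \val (repr c).1 ^ (repr c).2.

Lemma gaq_conjE (a : A) u : gaq_conj (\pi_(gaq A) (a, u)) = \val a ^ u.
Proof.
rewrite /gaq_conj; case E: (repr _) => [b v] /=.
have /gaqP[/= -> [g cga ->]] : \pi_(gaq A) (b, v) = \pi_(gaq A) (a, u).
  by rewrite -E reprK.
by rewrite conjgM; congr (_ ^ u); rewrite /conjg -cga mulKg.
Qed.

Lemma gaq_conj_op c d : gaq_conj (c *q d) = gaq_conj c ^ gaq_conj d.
Proof.
elim/quotW: c => -[a u]; elim/quotW: d => -[b v].
rewrite [_ *q _]gaq_opE !gaq_conjE -conjgM.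
by congr (_ ^ _); rewrite /conjg !mulgA.
Qed.

(** If [a ^ u = b ^ v], then [u * v^-1] conjugates [a] to [b]; so [a = b], and [u * v^-1]
    centralises [a]. *)
Lemma gaq_conj_inj : (forall (a b : A) g, \val b = \val a ^ g -> a = b) ->
  injective gaq_conj.
Proof.
move=> conjA; elim/quotW=> -[a u]; elim/quotW=> -[b v].
rewrite !gaq_conjE => auv.
have ab : a = b by apply: (conjA _ _ (u * v^-1)); rewrite conjgM auv conjgK.
subst b; apply/gaqP; split=> //=; exists (u * v^-1); last by rewrite mulgVK.
by apply: commute_sym; rewrite /commute conjgC conjgM auv conjgK.
Qed.

End ConjugationValue.

Section Orbits.
Local Open Scope quotient_scope.
Local Open Scope group_scope.
Variable Q : quandleType.

Lemma env_mapJ (x y : Q) : env_map (x *q y) = env_map x ^ env_map y.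
Proof. by rewrite env_mapM /conjg mulgA. Qed.

Lemma perm_subgroup_Inn : perm_subgroup (@Inn Q).
Proof.
split.
- move=> f If; apply: (If [set h | bijective h]); split=> [|_ [x _ <-]].
    split=> //=; first by exists id.
      by move=> h k bij_h bij_k; exact: bij_comp.
    by move=> h k _ hK kK; exists h.
  exact: qop_bij.
- by move=> H [[]].
- move=> f g If Ig H HP; have [[_ _ comp_H _] _] := HP.
  by apply: comp_H; [exact: If | exact: Ig].
- move=> f g If fK gK H HP; have [[_ _ _ inv_H] _] := HP.
  by apply: inv_H fK gK; exact: If.
Qed.

(** By minimality of [Inn]: the bijections inducing a conjugation on the generators form a
    permutation group containing every [qtrans y]. *)
Lemma env_map_Inn (f : Q -> Q) : Inn f ->
  exists g, forall x, env_map (f x) = env_map x ^ g.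
Proof.
pose H := [set f : Q -> Q | bijective f /\
  exists g, forall x, env_map (f x) = env_map x ^ g].
move=> If; suff [] : H f by [].
apply: If; split=> [|_ [y _ <-]]; last first.
  split; first exact: qop_bij.
  by exists (env_map y) => x; exact: env_mapJ.
split.
- by move=> h [].
- by split; [exists id | exists 1 => x; rewrite conjg1].
- move=> h k [bij_h [u hu]] [bij_k [v kv]].
  split; first exact: bij_comp.
  (* In [h \o k] the map [k] acts first, so its conjugator [v] stands on the left. *)
  by exists (v * u) => x /=; rewrite hu kv conjgM.
- move=> h k [_ [u hu]] hK kK; split; first by exists h.
  by exists u^-1 => x; rewrite -{2}[x]kK hu conjgK.
Qed.

(** Induction on a word for [g]: a letter [y] acts as [qtrans y], its inverse as the inverse map.
    The head letter conjugates first, so its map is composed on the inside. *)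
Lemma conj_env_map (g : env_group Q) :
  exists2 f : Q -> Q, Inn f & forall x, env_map (f x) = env_map x ^ g.
Proof.
have [_ Inn_id Inn_comp Inn_inv] := perm_subgroup_Inn.
have Inn_qtrans (y : Q) : Inn (qtrans y) by apply: sub_gen_smallest; exists y.
elim/quotW: g => w; elim: w => [|[y b] w [f If fw]].
  exists id => // x; rewrite -[LHS]conjg1; congr (_ ^ _).
  by rewrite -[1]/(presented_one _) !piE.
have -> : \pi_(env_group Q) ((y, b) :: w) =
    (if b then env_map y else (env_map y)^-1) * \pi_(env_group Q) w.
  rewrite -[_ :: w]/([:: (y, b)] ++ w) pi_presented_mul; congr (_ * _).
  by case: b => //; rewrite /env_map -[_^-1]/(presented_inv _) -pi_presented_inv.
case: b.
  exists (f \o qtrans y); first exact: Inn_comp.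
  by move=> x /=; rewrite fw env_mapJ conjgM.
have [h qK hK] := qop_bij y.
exists (f \o h); first by apply: Inn_comp => //; exact: Inn_inv (Inn_qtrans y) qK hK.
by move=> x /=; rewrite fw conjgM -{2}[x]hK env_mapJ conjgK.
Qed.

End Orbits.

Theorem theorem4p5 (Q : quandleType) (A : set Q)
    (theta_inj : injective (@env_map Q))
    (repA : orbit_representatives A) :
  quandle_iso Q (gaq (@env_map Q @` A)).
Proof.
set B := _ @` A.
have mem_orbit (x : Q) f : Inn f -> qorbit x (f x) by move=> If; exists f.
have conj_inj : injective (@gaq_conj _ B).
  apply: gaq_conj_inj => a b g ba.
  have [x Ax xa] := set_valP a; have [y Ay yb] := set_valP b.
  apply: val_inj; rewrite -xa -yb; congr env_map.
  have [f If fg] := conj_env_map g.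
  (* Injectivity of theta turns conjugacy in the enveloping group into equality of orbits. *)
  have yE : y = f x by apply: theta_inj; rewrite fg xa yb.
  have [_ Inn_id _ _] := perm_subgroup_Inn Q.
  have [z [_ z_uniq]] := repA x.
  have zx : z = x by apply: z_uniq; split=> //; exact: (mem_orbit x id).
  have zy : z = y by apply: z_uniq; split=> //; rewrite yE; exact: mem_orbit.
  by rewrite -zx -zy.
have /choice[F FE] (x : Q) : exists c : gaq B, gaq_conj c = env_map x.
  have [a [[Aa [f If fa]] _]] := repA x.
  have [g gE] := env_map_Inn If.
  have Ba : B (env_map a) by exists a.
  (* Since [env_map a = env_map x ^ g], conjugating by [g^-1] leads back to [env_map x]. *)
  exists (\pi_(gaq B)%qT (exist _ (env_map a) (mem_set Ba), g^-1)%g).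
  by rewrite gaq_conjE /= -fa gE conjgK.
have /choice[F' F'E] (c : gaq B) : exists x : Q, env_map x = gaq_conj c.
  elim/quotW: c => -[b u]; rewrite gaq_conjE.
  have [a _ <-] := set_valP b.
  by have [f _ fu] := conj_env_map u; exists (f a).
exists F; split.
  exists F' => [x|c]; first by apply: theta_inj; rewrite F'E FE.
  by apply: conj_inj; rewrite FE F'E.
(* Both embeddings turn [*q] into conjugation, so the comparison takes place in the group. *)
by move=> x y; apply: conj_inj; rewrite gaq_conj_op !FE env_mapJ.
Qed.
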